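(* Let $\theta_1,\theta_2$ be real numbers such that the pair $(\theta_1,\theta_2)$ is two-dimensional Diophantine with exponent $\alpha$. Then there is a constant $C_2(\theta_1,\theta_2)$ such that for every initial value $y_0$ and all $N\ge1$, the initial segment $(y_1,\dots,y_N)$ of the process $\mathcal{P}(\theta_1,\theta_2,y_0)$ satisfies $$\mathbb{E}\big[D(\{y_1,\dots,y_N\})\big] \le C_2(\theta_1,\theta_2)\, N^{-\frac{1}{2(1+\alpha)}}.$$
   Context: A pair $(\theta_1,\theta_2)$ of reals is two-dimensional Diophantine with exponent $\alpha$ if there is a constant $C(\theta_1,\theta_2)>0$ such that for all integers $k\ge1$, $\max(\|k\theta_1\|,\|k\theta_2\|)\ge C(\theta_1,\theta_2)k^{-\alpha}$, where $\|\xi\|:=\min_{n\in\mathbb{Z}}|\xi-n|$. Given real $\theta_1,\theta_2$ and an initial value $y_0$, the stochastic process $\mathcal{P}(\theta_1,\theta_2,y_0)$ has realizations $(y_1,y_2,\dots)$ generated by $y_{n+1}=y_n+\theta_1$ with probability $\frac12$ and $y_{n+1}=y_n+\theta_2$ with probability $\frac12$, for $n\ge0$, independently at each step. For real $y$, $\{\{y\}\}:=y-\lfloor y\rfloor$. The discrepancy of a finite list $\mathcal{Y}=\{y_1,\dots,y_N\}$ is $D(\mathcal{Y}) := \sup_{0\le \alpha'\le\beta\le 1}| \frac{1}{N}\#\{i : \alpha' \le \{\{y_i\}\} \le \beta\} - (\beta-\alpha')|$. *)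

(* Defs.v *)
From HB Require Import structures.
From mathcomp Require Import all_boot all_order all_algebra.
From mathcomp Require Import all_classical all_reals all_analysis.

Set Implicit Arguments.
Unset Strict Implicit.
Unset Printing Implicit Defensive.

Import Order.TTheory GRing.Theory Num.Theory.
Import numFieldNormedType.Exports.

Local Open Scope classical_set_scope.
Local Open Scope ring_scope.

(* The set is nonempty, bounded below by 0, and its infimum is attained, so
   this is min_{n in Z} |x - n|. *)
Definition dist_nearest_int (R : realType) (x : R) : R :=
  inf [set `|x - n%:~R| | n in [set: int]].

Definition diophantine2 (R : realType) (theta1 theta2 alpha : R) : Prop :=
  exists2 C : R, 0 < C & forall k : nat, (1 <= k)%N ->
    C * k%:R `^ (- alpha) <=
      Num.max (dist_nearest_int (k%:R * theta1))
              (dist_nearest_int (k%:R * theta2)).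

Definition frac_part (R : realType) (y : R) : R := y - (Num.floor y)%:~R.

(* The list is counted with multiplicity. For a nonempty list the set below
   is nonempty and bounded by 1, so the real-valued sup is the supremum. *)
Definition discrepancy (R : realType) (s : seq R) : R :=
  sup [set x : R | exists a b : R, [/\ 0 <= a, a <= b, b <= 1 &
    x = `|(count (fun y => (a <= frac_part y) && (frac_part y <= b)) s)%:R
            / (size s)%:R - (b - a)| ] ].

Section process.
Context (d : measure_display) (T : measurableType d) (R : realType).
Variable P : probability T R.

Definition mutually_independent (d' : measure_display) (U : measurableType d')
    (X : nat -> {RV P >-> U}) : Prop :=
  forall (s : seq nat) (B : nat -> set U), uniq s ->
    (forall i, measurable (B i)) ->
    P (\big[setI/setT]_(i <- s) (X i @^-1` B i)) =
      (\prod_(i <- s) P (X i @^-1` B i))%E.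

Definition fair_coins (b : nat -> {RV P >-> bool}) : Prop :=
  (forall (n : nat) (c : bool), P (b n @^-1` [set c]) = (2^-1)%:E) /\
  mutually_independent b.

(* The choice made at step n is recorded by a coin rather than by the increment
   y n.+1 - y n, which does not determine it when theta1 = theta2. *)
Definition is_process (theta1 theta2 y0 : R) (y : nat -> T -> R) : Prop :=
  exists b : nat -> {RV P >-> bool},
    [/\ fair_coins b,
        (forall w, y 0%N w = y0) &
        (forall n w, y n.+1 w = y n w + (if b n w then theta1 else theta2))].

End process.

(* Main.v *)
(** Let S_h be the average of e(h y_n) over the first N points. Writing |S_h|^2
    as a double sum and averaging over the coins gives
    E|S_h|^2 <= 4 / (N g), where g = sin^2(pi h theta1) + sin^2(pi h theta2) is
    the real part of 1 - (e(h theta1) + e(h theta2)) / 2, and the Diophantine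
    condition bounds g from below by a multiple of h^(-2 alpha). Hence
    E|S_h| = O(h^alpha N^(-1/2)), and the Erdos-Turan inequality
    D <= 3 sum_(h < H) |S_h| / h + 92 / H with H ~ N^(1 / (2 (1 + alpha)))
    yields the theorem, once alpha > 0 is known (pigeonhole principle).

    The Erdos-Turan inequality is obtained by smoothing the one-sided Lipschitz
    function rho(x) = #{n, k : y_n + k <= x} / N - x (suitably normalised) with
    the Fejer kernel: near an extremum rho stays extremal on an interval of
    length comparable to its oscillation, so the smoothed function, a
    trigonometric polynomial with coefficients O(|S_h| / h), sees it. The
    smoothing integral is replaced by a Riemann-Stieltjes sum against the
    antiderivative of the Fejer kernel. *)

Require Import Defs.
From HB Require Import structures.
From mathcomp Require Import all_boot all_order all_algebra.
From mathcomp Require Import ring lra.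
From mathcomp Require Import all_classical all_reals all_analysis.
From mathcomp Require Import measurable_realfun.
Import Order.TTheory GRing.Theory Num.Theory.
Import numFieldNormedType.Exports.
Local Open Scope classical_set_scope.
Local Open Scope ring_scope.

Set Implicit Arguments.
Unset Strict Implicit.
Unset Printing Implicit Defensive.

(** * The Fejer kernel and its antiderivative *)

Section fejer.
Context {R : realType}.
Implicit Types (x t u : R) (h m H : nat).

Lemma dirichlet_kernelE x m :
  sin x * (1 + 2 * \sum_(1 <= h < m.+1) cos (h%:R * (2 * x))) =
  sin ((2 * m%:R + 1) * x).
Proof.
elim: m => [|m IH]; first by rewrite big_geq// !mulr0 addr0 add0r mul1r mulr1.
rewrite big_nat_recr//= [2 * _]mulrDr addrA mulrDr IH.
set a := m.+1%:R * (2 * x).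
have -> : (2 * m%:R + 1) * x = a - x by rewrite /a -natr1; ring.
have -> : (2 * m.+1%:R + 1) * x = a + x by rewrite /a; ring.
by rewrite sinB sinD; ring.
Qed.

(** Going from [H] to [H.+1] adds a Dirichlet kernel to the bracket, and [sin ((H + 1) x) ^+ 2 - sin
    (H x) ^+ 2 = sin x * sin ((2 H + 1) x)]. *)
Lemma fejer_kernelE x H :
  sin x ^+ 2 *
    (H%:R + 2 * \sum_(1 <= h < H) (H%:R - h%:R) * cos (h%:R * (2 * x))) =
  sin (H%:R * x) ^+ 2.
Proof.
elim: H => [|H IH]; first by rewrite big_geq// mul0r sin0 !mulr0 addr0 mulr0 expr0n.
have -> : \sum_(1 <= h < H.+1) (H.+1%:R - h%:R) * cos (h%:R * (2 * x)) =
    \sum_(1 <= h < H) (H%:R - h%:R) * cos (h%:R * (2 * x)) +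
    \sum_(1 <= h < H.+1) cos (h%:R * (2 * x)).
  case: H {IH} => [|H]; first by rewrite !big_geq// addr0.
  rewrite [in LHS]big_nat_recr//= [X in _ = _ + X]big_nat_recr//= addrA.
  rewrite -big_split/=; congr (_ + _); last by rewrite -natr1; ring.
  by apply: eq_bigr => h _; rewrite -[H.+2%:R]natr1; ring.
have -> (A B : R) : sin x ^+ 2 * (H.+1%:R + 2 * (A + B)) =
    sin x ^+ 2 * (H%:R + 2 * A) + sin x * (sin x * (1 + 2 * B)).
  by rewrite -natr1; ring.
rewrite IH dirichlet_kernelE.
have -> : (2 * H%:R + 1) * x = H%:R * x + H.+1%:R * x by rewrite -natr1; ring.
have -> : sin x = sin (H.+1%:R * x - H%:R * x).
  by congr sin; rewrite -natr1; ring.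
rewrite sinB sinD.
have := cos2Dsin2 (H%:R * x); have := cos2Dsin2 (H.+1%:R * x).
move: (cos (H.+1%:R * x)) (sin (H.+1%:R * x)) (cos (H%:R * x))
  (sin (H%:R * x)) => c s c' s' h1 h2.
have e1 : c ^+ 2 = 1 - s ^+ 2 by rewrite -h1; ring.
have e2 : c' ^+ 2 = 1 - s' ^+ 2 by rewrite -h2; ring.
transitivity (s' ^+ 2 * (1 - c ^+ 2) + s ^+ 2 * c' ^+ 2); first by ring.
by rewrite e1 e2; ring.
Qed.

(** The odd antiderivative of the kernel [fejer]; its difference from [t] is a trigonometric
    polynomial of degree below [H]. *)
Definition fejer_primitive H t : R :=
  t + \sum_(1 <= h < H)
        (1 - h%:R / H%:R) * (pi * h%:R)^-1 * sin (2 * pi * h%:R * t).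

Lemma is_derive1_ge0_le (f df : R -> R) (a b : R) : a <= b ->
  (forall x, a <= x <= b -> is_derive x 1 f (df x)) ->
  (forall x, a < x < b -> 0 <= df x) -> f a <= f b.
Proof.
rewrite le_eqVlt => /predU1P[->//|ab] fdf df0.
have [| |c] := @MVT _ f df a b ab.
- by move=> x; rewrite in_itv/= => /andP[ax xb]; apply: fdf; rewrite !ltW.
- apply: derivable_within_continuous => x; rewrite in_itv/= => xab.
  by have [] := fdf _ xab.
rewrite in_itv/= => cab fE.
by rewrite -subr_ge0 fE mulr_ge0 ?subr_ge0 ?(ltW ab)// df0.
Qed.

(** For fixed [x], [sin t - t * cos x] is nondecreasing on [[0, x]], since [cos] decreases on
    [[0, pi]]. *)
Lemma cos_mul_le_sin x : 0 <= x <= pi -> x * cos x <= sin x.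
Proof.
move=> /andP[x0 xpi].
suff : sin 0 - 0 * cos x <= sin x - x * cos x.
  by rewrite sin0 mul0r subrr subr_ge0.
apply: (@is_derive1_ge0_le (fun t => sin t - t * cos x)
                           (fun t => cos t - cos x)) => //.
  move=> t _; apply: is_deriveB => //.
  rewrite (_ : (fun _ => _) = (cos x \*: id)); last first.
    by apply/funext => u /=; rewrite mulrC.
  by apply: is_derive_eq; rewrite [_ *: _]mulr1.
move=> t /andP[t0 tx]; rewrite subr_ge0 ltW// ltr_cos// in_itv/= ?x0//.
by rewrite (ltW t0) (ltW (lt_le_trans tx xpi)).
Qed.

(** The previous bound at [x / 2] and the double-angle formulas give
    [sin x >= (1 + cos x) * x / 2]. *)
Lemma half_le_sin x : 0 <= x <= pi / 2 -> x / 2 <= sin x.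
Proof.
move=> /andP[x0 xpi]; have pi0 := @pi_gt0 R.
have c0 : 0 <= cos x.
  by apply: cos_ge0_pihalf; rewrite xpi andbT (le_trans _ x0)// oppr_le0; lra.
have -> : sin x = 2 * (cos (x / 2) * sin (x / 2)).
  by rewrite mulr_natl -sin_mulr2n; congr sin; rewrite -mulr_natl; field.
have cE : cos x = 2 * cos (x / 2) ^+ 2 - 1.
  by rewrite mulr_natl -cos_mulr2n; congr cos; rewrite -mulr_natl; field.
have x2 : 0 <= x / 2 <= pi by lra.
have c20 : 0 <= cos (x / 2) by apply: cos_ge0_pihalf; lra.
have := ler_wpM2l c20 (cos_mul_le_sin x2).
by nra.
Qed.

Lemma le_sin_pi t : 0 <= t <= 1 / 2 -> t <= sin (pi * t).
Proof.
move=> t0; have pi0 := @pi_ge2 R.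
apply: le_trans (half_le_sin _); nra.
Qed.

Lemma is_derive_sum_nat m n (f df : nat -> R -> R) x :
  (forall h, (m <= h)%N -> is_derive x 1 (f h) (df h x)) ->
  is_derive x 1 (fun t => \sum_(m <= h < n) f h t) (\sum_(m <= h < n) df h x).
Proof.
move=> fdf; elim: n => [|n IH].
  rewrite big_geq//; rewrite (_ : (fun _ => _) = cst 0); first exact: is_derive_cst.
  by apply/funext => t; rewrite big_geq.
have [mn|nm] := leqP m n; last first.
  rewrite big_geq//; rewrite (_ : (fun _ => _) = cst 0); first exact: is_derive_cst.
  by apply/funext => t; rewrite big_geq.
rewrite big_nat_recr//=.
rewrite (_ : (fun _ => _) = (fun t => \sum_(m <= h < n) f h t) + f n).
  by apply: is_deriveD; exact: fdf.
by apply/funext => t; rewrite big_nat_recr.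
Qed.

Definition fejer H t : R :=
  1 + \sum_(1 <= h < H) 2 * (1 - h%:R / H%:R) * cos (2 * pi * h%:R * t).

Lemma is_derive_fejer_primitive H t :
  is_derive t 1 (fejer_primitive H) (fejer H t).
Proof.
apply: is_deriveD.
pose g h t : R := (1 - h%:R / H%:R) * (pi * h%:R)^-1 * sin (2 * pi * h%:R * t).
apply: (@is_derive_sum_nat _ _ g
  (fun h t => 2 * (1 - h%:R / H%:R) * cos (2 * pi * h%:R * t))) => h h0.
have pi0 : pi != 0 :> R by rewrite gt_eqF// pi_gt0.
have hn0 : h%:R != 0 :> R by rewrite pnatr_eq0 -lt0n.
rewrite (_ : g h = ((1 - h%:R / H%:R) * (pi * h%:R)^-1) \*:
    (sin \o ((2 * pi * h%:R) \*: id))); last by [].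
apply: is_derive_eq; rewrite /GRing.scale/=.
by move: (pi) pi0 (cos _) (H%:R^-1) => {g} p p0 c K; field; rewrite hn0.
Qed.

(** The closed form at [pi * t] has numerator in [[0, 1]], and [sin (pi * t) >= t]. *)
Lemma fejer_bounds H t : (0 < H)%N -> 0 < t <= 1 / 2 ->
  0 <= fejer H t <= H%:R^-1 * t ^- 2.
Proof.
move=> H0 /andP[t0 t2]; have Hp : 0 < H%:R :> R by rewrite ltr0n.
have st : t <= sin (pi * t) by apply: le_sin_pi; rewrite (ltW t0).
have FE : sin (pi * t) ^+ 2 * (H%:R * fejer H t) = sin (H%:R * (pi * t)) ^+ 2.
  rewrite -fejer_kernelE; congr (_ * _).
  rewrite /fejer mulrDr mulr1 !mulr_sumr; congr (_ + _).
  apply: eq_bigr => h _; rewrite (_ : 2 * pi * h%:R * t = h%:R * (2 * (pi * t))).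
    by move: (cos _) => c; field; rewrite gt_eqF.
  by ring.
have s0 : 0 < sin (pi * t) ^+ 2 by rewrite exprn_gt0// (lt_le_trans t0).
apply/andP; split.
  rewrite -(pmulr_rge0 _ Hp) -(pmulr_rge0 _ s0) FE; exact: sqr_ge0.
rewrite -(ler_pM2l Hp) mulrA divff ?gt_eqF// mul1r.
rewrite -(ler_pM2l s0) FE.
have s1 : sin (H%:R * (pi * t)) ^+ 2 <= 1.
  by rewrite -real_normK ?num_real// exprn_ile1// sin_max.
apply: le_trans s1 _; rewrite ler_pdivlMr ?exprn_gt0// mul1r.
by rewrite lerXn2r// nnegrE ltW// (lt_le_trans t0).
Qed.

Lemma fejer_primitiveN H t : fejer_primitive H (- t) = - fejer_primitive H t.
Proof.
rewrite /fejer_primitive opprD -sumrN; congr (_ + _).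
by apply: eq_bigr => h _; rewrite mulrN sinN mulrN.
Qed.

Lemma fejer_primitive0 H : fejer_primitive H 0 = 0.
Proof. by rewrite /fejer_primitive big1 ?addr0// => h _; rewrite mulr0 sin0 mulr0. Qed.

Lemma fejer_primitive_half H : fejer_primitive H (1 / 2) = 1 / 2.
Proof.
rewrite /fejer_primitive big1 ?addr0// => h _.
rewrite (_ : 2 * pi * h%:R * (1 / 2) = 0 + pi *+ h); last first.
  by rewrite -mulr_natr; field.
by rewrite alternatingn ?sin0 ?mulr0// => x; exact: sinDpi.
Qed.

Lemma fejer_primitive_le H t u : (0 < H)%N -> - (1 / 2) <= t -> t <= u ->
  u <= 1 / 2 -> fejer_primitive H t <= fejer_primitive H u.
Proof.
move=> H0.
have pos a b : 0 <= a -> a <= b -> b <= 1 / 2 ->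
    fejer_primitive H a <= fejer_primitive H b.
  move=> a0 ab b2; apply: (@is_derive1_ge0_le _ (fejer H)) => //.
    by move=> x _; exact: is_derive_fejer_primitive.
  move=> x /andP[ax xb].
  have /andP[]// : 0 <= fejer H x <= H%:R^-1 * x ^- 2.
  by apply: fejer_bounds => //; lra.
move=> t1 tu u1; have [t0|t0] := leP 0 t; first exact: pos.
have [u0|u0] := leP u 0.
  rewrite -[t]opprK -[u]opprK !(fejer_primitiveN _ (- _)) lerN2.
  by apply: pos; lra.
apply: (@le_trans _ _ 0); last by rewrite -(fejer_primitive0 H); apply: pos; lra.
rewrite -[t]opprK fejer_primitiveN oppr_le0 -(fejer_primitive0 H).
by apply: pos; lra.
Qed.

(** The left side is the mass of the kernel on [[t, 1 / 2]]; the bound [1 / (H x ^+ 2)] is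
    integrated through the monotonicity of [f]. *)
Lemma fejer_primitive_tail H t : (0 < H)%N -> 0 < t <= 1 / 2 ->
  1 / 2 - fejer_primitive H t <= (H%:R * t)^-1.
Proof.
move=> H0 /andP[t0 t2].
have Hp : 0 < H%:R :> R by rewrite ltr0n.
pose f (x : R) := - (H%:R^-1 * x^-1 + fejer_primitive H x).
suff : f t <= f (1 / 2).
  rewrite /f fejer_primitive_half invfM => fle.
  have : 0 <= H%:R^-1 * (1 / 2)^-1 :> R by rewrite mulr_ge0// invr_ge0; lra.
  by lra.
apply: (@is_derive1_ge0_le _ (fun x => H%:R^-1 * x ^- 2 - fejer H x)) => //.
  move=> x /andP[tx x2].
  have dF := is_derive_fejer_primitive H x.
  have x0 : x != 0 by rewrite gt_eqF// (lt_le_trans t0).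
  rewrite (_ : f = - (H%:R^-1 \*: (fun x : R => (id x)^-1) + fejer_primitive H)) //.
  have dV := @is_deriveV R id x 1 1 x0 (is_derive_id _ _).
  by apply: is_derive_eq; rewrite /GRing.scale/=; ring.
move=> x /andP[tx x2].
have /andP[_] : 0 <= fejer H x <= H%:R^-1 * x ^- 2.
  by apply: fejer_bounds => //; lra.
by rewrite subr_ge0.
Qed.

End fejer.

(** * Smoothing argument for the Erdos-Turan inequality *)

Section erdos_turan.
Context {R : realType}.
Variable (H : nat).
Hypothesis H_gt0 : (0 < H)%N.
Implicit Types (x u : R) (j : nat).

Let HR_gt0 : 0 < H%:R :> R. Proof. by rewrite ltr0n. Qed.

Local Notation P := (@fejer_primitive R H).

(** The period [[-1/2, 1/2]] is cut into [H] equal cells; [weight j] is the Fejer mass of the cell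
    from [node j] to [node j.+1]. *)
Let node j : R := j%:R / H%:R - 1 / 2.
Let weight j : R := P (node j.+1) - P (node j).

Let nodeS j : node j.+1 = node j + H%:R^-1.
Proof. by rewrite /node -natr1 mulrDl mul1r addrAC. Qed.

Let node0 : node 0 = - (1 / 2).
Proof. by rewrite /node mul0r add0r. Qed.

Let nodeH : node H = 1 / 2.
Proof. by rewrite /node divff ?gt_eqF//; field. Qed.

Let node_leS j : node j <= node j.+1.
Proof. by rewrite nodeS lerDl invr_ge0 ltW. Qed.

Let node_ge j : - (1 / 2) <= node j.
Proof. by rewrite -node0; elim: j => // j; move/le_trans; apply. Qed.

Let node_le j : (j <= H)%N -> node j <= 1 / 2.
Proof.
by move=> jH; rewrite -nodeH /node lerD2r ler_pM2r ?invr_gt0// ler_nat.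
Qed.

Let nodeN j : (j <= H)%N -> node (H - j) = - node j.
Proof. by move=> jH; rewrite /node natrB//; field; rewrite gt_eqF. Qed.

Let weight_ge0 j : (j < H)%N -> 0 <= weight j.
Proof.
by move=> jH; rewrite subr_ge0 fejer_primitive_le//; exact: node_le.
Qed.

Let sum_weight : \sum_(0 <= j < H) weight j = 1.
Proof.
rewrite telescope_sumr// node0 nodeH fejer_primitiveN fejer_primitive_half.
by field.
Qed.

(** The reflection [j -> H - 1 - j] negates the cells and, [P] being odd, preserves their
    weights. *)
Let sum_weight_rev (f : R -> R -> R) :
  \sum_(0 <= j < H) weight j * f (node j) (node j.+1) =
  \sum_(0 <= j < H) weight j * f (- node j.+1) (- node j).
Proof.
rewrite big_nat_rev/= add0n [LHS]big_nat [RHS]big_nat.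
apply: eq_bigr => j /= jH; rewrite /weight subnSK// !nodeN ?(ltnW jH)//.
by rewrite !fejer_primitiveN opprK [- _ + _]addrC.
Qed.

Let weight_moment : \sum_(0 <= j < H) weight j * node j = - (2 * H%:R)^-1.
Proof.
have e1 := sum_weight_rev (fun a _ => a); rewrite /= in e1.
have : \sum_(0 <= j < H) weight j * node j + \sum_(0 <= j < H) weight j * node j
    = - H%:R^-1.
  rewrite {1}e1 -big_split/=.
  under eq_bigr do rewrite nodeS -mulrDr opprD addrAC addNr add0r.
  by rewrite -mulr_suml sum_weight mul1r.
by rewrite invfM => h; lra.
Qed.

Let weight_momentS : \sum_(0 <= j < H) weight j * node j.+1 = (2 * H%:R)^-1.
Proof.
rewrite (sum_weight_rev (fun _ b => b)) -[RHS]opprK -weight_moment -sumrN.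
by apply: eq_bigr => j _; rewrite mulrN.
Qed.

(** Each summand is the mass of the part of cell [j] to the right of [u]. *)
Let sum_clamp u : - (1 / 2) <= u <= 1 / 2 ->
  \sum_(0 <= j < H) (P (Num.max (node j.+1) u) - P (Num.max (node j) u)) =
  1 / 2 - P u.
Proof.
move=> /andP[u1 u2]; rewrite telescope_sumr// node0 nodeH.
by rewrite (max_idPl u2) (max_idPr u1) fejer_primitive_half.
Qed.

Let sum_weight_gt u : - (1 / 2) <= u <= 1 / 2 ->
  \sum_(0 <= j < H) weight j * (u < node j)%R%:R <= 1 / 2 - P u.
Proof.
move=> u2; rewrite -sum_clamp// big_nat [leRHS]big_nat.
apply: ler_sum => j /= jH; move/andP: u2 => [u1 u2].
have [uj|ju] := ltP u (node j).
  by rewrite mulr1 max_l// (le_trans (ltW uj)).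
by rewrite mulr0 subr_ge0 fejer_primitive_le// ?le_max ?lexx ?orbT// ge_max node_le.
Qed.

Let sum_weightS_gt u : - (1 / 2) <= u <= 1 / 2 ->
  1 / 2 - P u <= \sum_(0 <= j < H) weight j * (u < node j.+1)%R%:R.
Proof.
move=> u2; rewrite -sum_clamp// big_nat [leRHS]big_nat.
apply: ler_sum => j /= jH; move/andP: u2 => [u1 u2].
have [uj|ju] := ltP u (node j.+1).
  rewrite mulr1 lerD2l lerN2 fejer_primitive_le// ?le_max ?lexx//.
  by rewrite ge_max node_le// ltnW.
by rewrite mulr0 max_r ?subrr// (le_trans (node_leS _)).
Qed.

Let floorN x : -1 <= x < 1 -> (Num.floor x)%:~R = - (x < 0)%R%:R :> R.
Proof.
move=> /andP[x1 x2]; have [x0|x0] := ltP x 0.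
  by rewrite (@floor_def _ _ (-1)) ?mulrN1z//= ?x1 ?addNr.
by rewrite (@floor_def _ _ 0) ?x0 ?add0r// oppr0.
Qed.

Let fejer_primitiveDz x (n : int) : P (x + n%:~R) = P x + n%:~R.
Proof.
rewrite /fejer_primitive addrAC; congr (_ + _ + _); apply: eq_bigr => h _.
congr (_ * _).
have per (m : nat) (y : R) : sin (y + 2 * pi * h%:R * m%:R) = sin y.
  rewrite (_ : 2 * pi * h%:R * m%:R = (pi *+ 2) *+ (h * m)).
    by rewrite periodicn//; exact: sinD2pi.
  by rewrite -[RHS]mulr_natr natrM -[pi *+ 2]mulr_natl !mulrA.
rewrite mulrDr; case: n => m; first exact: per.
rewrite NegzE mulrNz mulrN.
by rewrite -[in RHS](subrK (2 * pi * h%:R * m.+1%:R) (2 * pi * h%:R * x)) per.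
Qed.

(** [P u - 1 / 2] is the exact Fejer average of [floor (u - t)]: on one period this function is, up
    to an integer, minus the indicator of [t > r]. It is nonincreasing in [t], so right endpoints
    give a lower sum and left endpoints an upper sum. *)
Let floor_smooth u :
  \sum_(0 <= j < H) weight j * (Num.floor (u - node j.+1))%:~R <= P u - 1 / 2 /\
  P u - 1 / 2 <= \sum_(0 <= j < H) weight j * (Num.floor (u - node j))%:~R.
Proof.
set n := Num.floor (u + 1 / 2); pose r := u - n%:~R.
have uE : u = r + n%:~R by rewrite subrK.
have r1 : - (1 / 2) <= r by have := floor_le (u + 1 / 2); rewrite -/n /r; lra.
have r2 : r < 1 / 2.
  by have := floorD1_gt (u + 1 / 2); rewrite -/n /r intrD; lra.
have rE (f : nat -> R) : (forall j, (j < H)%N -> - (1 / 2) <= f j <= 1 / 2) ->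
    \sum_(0 <= j < H) weight j * (Num.floor (u - f j))%:~R =
    n%:~R - \sum_(0 <= j < H) weight j * (r < f j)%R%:R.
  move=> fj.
  have -> : n%:~R = \sum_(0 <= j < H) weight j * n%:~R :> R.
    by rewrite -mulr_suml sum_weight mul1r.
  rewrite -sumrB.
  rewrite [LHS]big_nat [RHS]big_nat; apply: eq_bigr => j /= jH.
  rewrite uE addrAC floorDrz ?intr_int// intrKfloor intrD.
  have := fj _ jH => /andP[f1 f2].
  rewrite floorN; last by lra.
  by rewrite subr_lt0; ring.
rewrite !rE; last 2 first.
- by move=> j jH; rewrite node_ge node_le// ltnW.
- by move=> j jH; rewrite node_ge node_le.
rewrite uE fejer_primitiveDz.
have r12 : - (1 / 2) <= r <= 1 / 2 by lra.
have := sum_weight_gt r12; have := sum_weightS_gt r12.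
by split; lra.
Qed.


Variable s : seq R.
Hypothesis s_gt0 : (0 < size s)%N.

Let N : R := (size s)%:R.
Let N_gt0 : 0 < N. Proof. by rewrite ltr0n. Qed.

(* [rho b - rho a] is the signed discrepancy of the arc [(a, b]] of R/Z, so
   arcs that wrap around need no separate treatment. *)
Let rho x : R := N^-1 * \sum_(y <- s) (Num.floor (x - y))%:~R - x.

Let rho_lip x u : 0 <= u -> rho x - u <= rho (x + u).
Proof.
move=> u0; rewrite /rho opprD addrA lerD2r lerD2r ler_pM2l ?invr_gt0//.
by apply: ler_sum => y _; rewrite ler_int le_floor// lerD2r lerDl.
Qed.

Let mean : R := N^-1 * \sum_(y <- s) y.

Let sumN (c : R) : N^-1 * \sum_(y <- s) c = c.
Proof.
by rewrite big_const_seq count_predT iter_addr_0 -mulr_natl mulrA mulVf ?gt_eqF// mul1r.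
Qed.

(** A crude bound, which makes the oscillation of [rho] a finite supremum. *)
Let rho_osc1 a b : rho b - rho a <= 1.
Proof.
have hi x : rho x <= - mean.
  rewrite lerBlDr /mean -mulrN -{2}(sumN x) -mulrDr ler_pM2l ?invr_gt0//.
  rewrite -sumrN -big_split/=; apply: ler_sum => y _.
  by rewrite addrC floor_le.
have lo x : - mean - 1 <= rho x.
  rewrite lerBrDr /mean -mulrN -{1}(sumN x) -{1}(sumN 1) -mulrBr -mulrDr.
  rewrite ler_pM2l ?invr_gt0//.
  rewrite -sumrN -sumrB -big_split/=; apply: ler_sum => y _.
  by have := floorD1_gt (x - y); rewrite intrD; lra.
by have := hi b; have := lo a; lra.
Qed.

(** The quantity bounded by [E] is a trigonometric polynomial in [x], to be estimated by exponential
    sums over [s]. *)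
Variable E : R.
Hypothesis smooth_le : forall x,
  `|N^-1 * \sum_(y <- s) (P (x - y) - (x - y))| <= E.

Let sum_rho (f : nat -> R) x : \sum_(0 <= j < H) weight j * rho (x - f j) =
  N^-1 * (\sum_(y <- s) \sum_(0 <= j < H)
      weight j * (Num.floor (x - y - f j))%:~R)
  - x + \sum_(0 <= j < H) weight j * f j.
Proof.
have xE : x = \sum_(0 <= j < H) weight j * x.
  by rewrite -mulr_suml sum_weight mul1r.
rewrite exchange_big/= mulr_sumr [X in _ - X + _]xE.
rewrite -sumrB -big_split/=; apply: eq_bigr => j _.
rewrite /rho -mulr_sumr.
under [in LHS]eq_bigr do rewrite addrAC.
by ring.
Qed.

Let sum_P x : N^-1 * \sum_(y <- s) (P (x - y) - 1 / 2) - x =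
  N^-1 * \sum_(y <- s) (P (x - y) - (x - y)) - mean - 1 / 2.
Proof.
rewrite -[X in _ = _ - X](sumN (1 / 2)) -[X in _ - X = _](sumN x) /mean -!mulrBr.
congr (_ * _).
by rewrite -!sumrB; apply: eq_bigr => y _; ring.
Qed.

(** The constant [- mean - 1 / 2] is the mean of [rho] over a period; [(2 H)^-1] is the first moment
    lost by sampling cells at an endpoint. *)
Let smooth_lower x : - mean - 1 / 2 - E - (2 * H%:R)^-1 <=
  \sum_(0 <= j < H) weight j * rho (x - node j).
Proof.
rewrite sum_rho weight_moment lerD2r.
apply: (@le_trans _ _ (N^-1 * \sum_(y <- s) (P (x - y) - 1 / 2) - x)).
  by rewrite sum_P; have := smooth_le x; rewrite ler_norml; lra.
rewrite lerD2r ler_pM2l ?invr_gt0//; apply: ler_sum => y _.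
by have [] := floor_smooth (x - y).
Qed.

Let smooth_upper x : \sum_(0 <= j < H) weight j * rho (x - node j.+1) <=
  - mean - 1 / 2 + E + (2 * H%:R)^-1.
Proof.
rewrite (sum_rho (fun j => node j.+1)) weight_momentS lerD2r.
apply: (@le_trans _ _ (N^-1 * \sum_(y <- s) (P (x - y) - 1 / 2) - x)).
  rewrite lerD2r ler_pM2l ?invr_gt0//; apply: ler_sum => y _.
  by have [] := floor_smooth (x - y).
by rewrite sum_P; have := smooth_le x; rewrite ler_norml; lra.
Qed.

(** Marks the cells wholly outside [[-d, d]]; cells that straddle the boundary count as near, hence
    the radius [d + 1 / H] below. *)
Let far d j : R := (d < node j)%R%:R + (node j.+1 < - d)%R%:R.

Let sum_far d : 0 < d <= 1 / 2 ->
  \sum_(0 <= j < H) weight j * far d j <= 2 * (H%:R * d)^-1.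
Proof.
move=> d2; under eq_bigr do rewrite mulrDr.
rewrite big_split/= (sum_weight_rev (fun _ b => (b < - d)%R%:R)).
under [X in _ + X]eq_bigr do rewrite ltrN2.
have dd : - (1 / 2) <= d <= 1 / 2 by lra.
have := sum_weight_gt dd; have := fejer_primitive_tail H_gt0 d2.
by lra.
Qed.

Let sum_near a d B (f : nat -> R) : 0 < d <= 1 / 2 -> 0 <= B ->
  (forall j, (j < H)%N -> f j <= a + 2 * (d + H%:R^-1) + B * far d j) ->
  \sum_(0 <= j < H) weight j * f j <=
  a + 2 * (d + H%:R^-1) + B * (2 * (H%:R * d)^-1).
Proof.
move=> d2 B0 fj.
apply: (@le_trans _ _ (\sum_(0 <= j < H)
    weight j * (a + 2 * (d + H%:R^-1) + B * far d j))).
  rewrite big_nat [leRHS]big_nat; apply: ler_sum => j /= jH.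
  by rewrite ler_wpM2l ?weight_ge0 ?fj.
under eq_bigr do rewrite mulrDr.
rewrite big_split/= -mulr_suml sum_weight mul1r lerD2l.
under eq_bigr do rewrite mulrCA.
by rewrite -mulr_sumr ler_wpM2l// sum_far.
Qed.

Let near_case d j (Q : Prop) : 0 < d ->
  (`|node j| <= d + H%:R^-1 -> `|node j.+1| <= d + H%:R^-1 -> far d j = 0 -> Q) ->
  (1 <= far d j -> Q) -> Q.
Proof.
move=> d0 q1 q2; have HV : 0 < H%:R^-1 :> R by rewrite invr_gt0.
have [dj|jd] := ltP d (node j).
  by apply: q2; rewrite /far dj lerDl.
have [dj|jd'] := ltP (node j.+1) (- d).
  by apply: q2; rewrite /far dj lerDr.
apply: q1; last by rewrite /far !ltNge jd jd' addr0.
- by rewrite nodeS in jd'; rewrite ler_norml; lra.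
- by rewrite nodeS in jd' *; rewrite ler_norml; lra.
Qed.

(** By [rho_lip], [rho] is at most [rho a + 2 d'] on the window of length [2 d'] ending at [a], and
    at least [rho b - 2 d'] on the one starting at [b]. Both smoothed values, centred in these
    windows, are compared with the same constant; far cells cost at most [B] each. *)
Let rho_osc_step a b d B : 0 < d <= 1 / 2 ->
  (forall a b, rho b - rho a <= B) ->
  rho b - rho a <= 2 * E + 5 * H%:R^-1 + 4 * d + 4 * B * (H%:R * d)^-1.
Proof.
move=> d2 osc; have B0 : 0 <= B by have := osc 0 0; rewrite subrr.
have d0 : 0 < d by case/andP: d2.
set d' := d + H%:R^-1.
have lo := smooth_lower (a - d').
have lo' : \sum_(0 <= j < H) weight j * rho (a - d' - node j) <=
    rho a + 2 * d' + B * (2 * (H%:R * d)^-1).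
  apply: sum_near => // j jH; rewrite -/d'.
  apply: (@near_case d j _ d0); rewrite -/d'.
    rewrite ler_norml => /andP[n1 n2] _ ->; rewrite mulr0 addr0.
    have z0 : 0 <= d' + node j by lra.
    have := rho_lip (a - d' - node j) z0.
    rewrite (_ : a - d' - node j + (d' + node j) = a); last by ring.
    by lra.
  move=> far1; have := osc a (a - d' - node j).
  have : B <= B * far d j by rewrite ler_peMr.
  have : 0 < H%:R^-1 :> R by rewrite invr_gt0.
  by rewrite /d'; lra.
have up := smooth_upper (b + d').
have up' : \sum_(0 <= j < H) weight j * - rho (b + d' - node j.+1) <=
    - rho b + 2 * d' + B * (2 * (H%:R * d)^-1).
  apply: sum_near => // j jH; rewrite -/d'.
  apply: (@near_case d j _ d0); rewrite -/d'.
    move=> _; rewrite ler_norml => /andP[n1 n2] ->; rewrite mulr0 addr0.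
    have z0 : 0 <= d' - node j.+1 by lra.
    have := rho_lip b z0.
    rewrite addrA; lra.
  move=> far1; have := osc (b + d' - node j.+1) b.
  have : B <= B * far d j by rewrite ler_peMr.
  have : 0 < H%:R^-1 :> R by rewrite invr_gt0.
  by rewrite /d'; lra.
move: up'; under eq_bigr do rewrite mulrN.
rewrite sumrN => up'.
rewrite invfM in lo up *; rewrite /d' in lo' up'.
by lra.
Qed.

(* Taking [B] in [rho_osc_step] to be the oscillation itself and [d = B / 16]
   makes the bound self-improving. *)
Let rho_osc a b : rho b - rho a <= 3 * E + 92 * H%:R^-1.
Proof.
pose S := [set x | exists a b, x = rho b - rho a].
have ubS : has_ubound S by exists 1 => _ [a' [b' ->]]; exact: rho_osc1.
have S0 : S !=set0 by exists (rho 0 - rho 0), 0, 0.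
have osc a' b' : rho b' - rho a' <= sup S by apply: ub_le_sup => //; exists a', b'.
apply: le_trans (osc a b) _.
have HV : 0 < H%:R^-1 :> R by rewrite invr_gt0.
have E0 : 0 <= E by apply: le_trans (smooth_le 0).
have [S_le0|S_gt0] := leP (sup S) 0; first by lra.
have S_le1 : sup S <= 1 by apply: ge_sup => // _ [a' [b' ->]]; exact: rho_osc1.
have d2 : 0 < sup S / 16 <= 1 / 2 by lra.
have : sup S <= 2 * E + 5 * H%:R^-1 + 4 * (sup S / 16) +
    4 * sup S * (H%:R * (sup S / 16))^-1.
  by apply: ge_sup => // _ [a' [b' ->]]; exact: rho_osc_step.
have -> : 4 * sup S * (H%:R * (sup S / 16))^-1 = 64 * H%:R^-1.
  by field; rewrite !gt_eqF.
(* What remains is [3/4 * sup S <= 2 E + 69 / H], and [69 * 4 / 3 = 92]. *)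
by lra.
Qed.

Lemma discrepancy_le_smooth : discrepancy s <= 3 * E + 92 * H%:R^-1.
Proof.
apply: ge_sup.
  pose c := count (fun y => (0 <= frac_part y) && (frac_part y <= 0)) s.
  by exists `|c%:R / N - (0 - 0)|, 0, 0; split; rewrite ?ler01.
move=> _ [a [b [a0 ab b1 ->]]].
set c := count _ s.
have cE : c%:R = \sum_(y <- s) ((a <= frac_part y) && (frac_part y <= b))%R%:R :> R.
  by rewrite /c -sum1_count natr_sum big_mkcond/=; apply: eq_bigr => y _; case: ifP.
rewrite -/N; apply/ler_addgt0Pr => e e0.
have fl (y : R) : (Num.floor y)%:~R <= y < (Num.floor y)%:~R + 1.
  by rewrite floor_le/=; have := floorD1_gt y; rewrite intrD.
(* The arc [(a - e, b]] contains the closed interval [[a, b]]. *)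
have up : c%:R <= \sum_(y <- s)
    ((Num.floor (b - y))%:~R - (Num.floor (a - e - y))%:~R) :> R.
  rewrite cE; apply: ler_sum => y _.
  have [/andP[fa fb]|_] := boolP (_ && _).
    rewrite /frac_part in fa fb; set n := Num.floor y in fa fb.
    have : (- n)%:~R <= (Num.floor (b - y))%:~R :> R.
      by rewrite ler_int floor_ge_int mulrNz; lra.
    have : (Num.floor (a - e - y) + 1)%:~R <= (- n)%:~R :> R.
      by rewrite ler_int lezD1 floor_lt_int mulrNz; lra.
    by rewrite intrD /=; lra.
  by rewrite subr_ge0 ler_int le_floor//; lra.
(* Ending at [b - e] matters when [b = 1]: the arc [(a, 1]] of the circle contains the points of
   fractional part 0, which [[a, 1]] misses if [a > 0]. *)
have lo : \sum_(y <- s)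
    ((Num.floor (b - e - y))%:~R - (Num.floor (a - y))%:~R) <= c%:R :> R.
  rewrite cE; apply: ler_sum => y _.
  have := fl y; rewrite /frac_part; set n := Num.floor y => yn.
  have hi : (Num.floor (b - e - y))%:~R <= (- n)%:~R :> R.
    by rewrite ler_int -ltzD1 floor_lt_int intrD mulrNz; lra.
  have lw : (- n - 1)%:~R <= (Num.floor (a - y))%:~R :> R.
    by rewrite ler_int floor_ge_int intrB mulrNz; lra.
  rewrite intrB mulrNz in lw; rewrite mulrNz in hi.
  have [_|] := boolP (_ && _); first by rewrite /=; lra.
  rewrite negb_and -!ltNge /= => /orP[ya|by'].
    have : (- n)%:~R <= (Num.floor (a - y))%:~R :> R.
      by rewrite ler_int floor_ge_int mulrNz; lra.
    by rewrite mulrNz; lra.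
  have : (Num.floor (b - e - y) + 1)%:~R <= (- n)%:~R :> R.
    by rewrite ler_int lezD1 floor_lt_int mulrNz; lra.
  by rewrite intrD mulrNz; lra.
rewrite ler_norml; apply/andP; split.
  have := rho_osc (b - e) a; rewrite /rho.
  move: lo; rewrite -(ler_pM2l (_ : 0 < N^-1)) ?invr_gt0// sumrB mulrBr.
  by rewrite [c%:R / N]mulrC; lra.
have := rho_osc (a - e) b; rewrite /rho.
move: up; rewrite -(ler_pM2l (_ : 0 < N^-1)) ?invr_gt0// sumrB mulrBr.
by rewrite [c%:R / N]mulrC; lra.
Qed.

End erdos_turan.

(** * Discrepancy bounded by exponential sums *)

Section weyl_sums.
Context {R : realType}.
Implicit Types (s : seq R) (h H : nat).

(* The squared modulus of the exponential sum of frequency [h] over [s]. *)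
Definition weyl_sq h s : R :=
  (\sum_(y <- s) cos (2 * pi * h%:R * y)) ^+ 2 +
  (\sum_(y <- s) sin (2 * pi * h%:R * y)) ^+ 2.

Lemma weyl_sq_ge0 h s : 0 <= weyl_sq h s.
Proof. by rewrite addr_ge0// sqr_ge0. Qed.

(** The left side is, up to sign, one coordinate of the exponential sum after a rotation by the
    angle [A]. *)
Lemma norm_sum_sin_le h s (x : R) :
  `|\sum_(y <- s) sin (2 * pi * h%:R * (x - y))| <= Num.sqrt (weyl_sq h s).
Proof.
under eq_bigr do rewrite mulrBr sinB.
rewrite sumrB -mulr_sumr -mulr_sumr /weyl_sq.
set A := 2 * pi * h%:R * x.
move: (\sum_(_ <- _) cos _) (\sum_(_ <- _) sin _) => C S.
rewrite -sqrtr_sqr ler_wsqrtr//.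
have c2 : cos A ^+ 2 = 1 - sin A ^+ 2 by rewrite -(cos2Dsin2 A) addrK.
suff -> : (sin A * C - cos A * S) ^+ 2 =
    C ^+ 2 + S ^+ 2 - (cos A * C + sin A * S) ^+ 2.
  by rewrite gerBl sqr_ge0.
transitivity (sin A ^+ 2 * C ^+ 2 - 2 * (sin A * cos A * C * S) +
  cos A ^+ 2 * S ^+ 2); first by ring.
transitivity (C ^+ 2 + S ^+ 2 - (cos A ^+ 2 * C ^+ 2 +
  2 * (sin A * cos A * C * S) + sin A ^+ 2 * S ^+ 2)); last by ring.
by rewrite c2; ring.
Qed.

(** The coefficients [(1 - h / H) / (pi h)] of [P t - t] are at most [1 / h]. *)
Lemma erdos_turan H s : (0 < H)%N -> (0 < size s)%N ->
  discrepancy s <=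
  3 * \sum_(1 <= h < H) h%:R^-1 * ((size s)%:R^-1 * Num.sqrt (weyl_sq h s)) +
  92 * H%:R^-1.
Proof.
move=> H0 s0; apply: discrepancy_le_smooth => // x.
have HR : 0 < H%:R :> R by rewrite ltr0n.
under eq_bigr do rewrite /fejer_primitive [X in X - _]addrC addrK.
rewrite exchange_big/= mulr_sumr; apply: le_trans (ler_norm_sum _ _ _) _.
rewrite [leLHS]big_nat [leRHS]big_nat; apply: ler_sum => h /andP[h0 hH].
rewrite -mulr_sumr mulrCA normrM.
have hR : 0 < h%:R :> R by rewrite ltr0n.
apply: ler_pM => //.
  have q0 : 0 <= h%:R / H%:R :> R by rewrite divr_ge0// ltW.
  have q1 : h%:R / H%:R <= 1 :> R by rewrite ler_pdivrMr// mul1r ler_nat ltnW.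
  have p0 : 0 <= (pi * h%:R)^-1 :> R by rewrite invr_ge0 mulr_ge0 ?pi_ge0.
  have p1 : (pi * h%:R)^-1 <= h%:R^-1 :> R.
    rewrite lef_pV2 ?posrE ?mulr_gt0 ?pi_gt0//.
    by rewrite ler_peMl// (le_trans _ (@pi_ge2 R))// ler1n.
  rewrite ger0_norm ?mulr_ge0 ?subr_ge0// -[leRHS]mul1r.
  by rewrite ler_pM ?subr_ge0// gerBl.
by rewrite normrM ger0_norm ?invr_ge0// ler_wpM2l ?invr_ge0// norm_sum_sin_le.
Qed.

End weyl_sums.

(** * Averages over finitely many coin tosses *)

Section bit_average.
Context {R : realType}.
Implicit Types (f g : bitseq -> R) (n : nat).

Fixpoint bitseqs n : seq bitseq :=
  if n is m.+1 then map (cons true) (bitseqs m) ++ map (cons false) (bitseqs m)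
  else [:: [::]].

Definition bit_avg n f : R := 2^-1 ^+ n * \sum_(v <- bitseqs n) f v.

Lemma bit_avg0 f : bit_avg 0 f = f [::].
Proof. by rewrite /bit_avg big_seq1 expr0 mul1r. Qed.

Lemma bit_avgS n f :
  bit_avg n.+1 f = 2^-1 * (bit_avg n (f \o cons true) + bit_avg n (f \o cons false)).
Proof. by rewrite /bit_avg big_cat !big_map exprS -mulrA -mulrDr. Qed.

Lemma eq_bit_avg n f g : f =1 g -> bit_avg n f = bit_avg n g.
Proof. by move=> fg; rewrite /bit_avg; under eq_bigr do rewrite fg. Qed.

Lemma bit_avg_cst n (c : R) : bit_avg n (fun=> c) = c.
Proof. by elim: n => [|n IH]; rewrite ?bit_avg0// bit_avgS !IH; field. Qed.

Lemma bit_avgD n f g : bit_avg n (fun v => f v + g v) = bit_avg n f + bit_avg n g.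
Proof. by rewrite /bit_avg big_split mulrDr. Qed.

Lemma bit_avgZ n (c : R) f : bit_avg n (fun v => c * f v) = c * bit_avg n f.
Proof. by rewrite /bit_avg -mulr_sumr mulrCA. Qed.

Lemma bit_avg_sum n (I : Type) (r : seq I) (F : I -> bitseq -> R) :
  bit_avg n (fun v => \sum_(i <- r) F i v) = \sum_(i <- r) bit_avg n (F i).
Proof. by rewrite /bit_avg exchange_big mulr_sumr. Qed.

Lemma size_bitseqs n v : v \in bitseqs n -> size v = n.
Proof.
elim: n v => [|n IH] v; first by rewrite inE => /eqP ->.
by rewrite mem_cat => /orP[] /mapP[u /IH su ->] /=; rewrite su.
Qed.

Lemma le_bit_avg n f g : (forall v, size v = n -> f v <= g v) ->
  bit_avg n f <= bit_avg n g.
Proof.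
move=> fg; rewrite ler_wpM2l ?exprn_ge0 ?invr_ge0//.
rewrite big_seq [leRHS]big_seq; apply: ler_sum => v /size_bitseqs; exact: fg.
Qed.

(** Used to write a function of [n] coins as a finite combination of indicators. *)
Lemma sum_bitseqs_delta n f v : size v = n ->
  \sum_(u <- bitseqs n) f u * (u == v)%:R = f v.
Proof.
elim: n f v => [|n IH] f [|c v]//; first by rewrite big_seq1 eqxx mulr1.
move=> [sv]; rewrite big_cat !big_map/=.
have key b : \sum_(u <- bitseqs n) f (b :: u) * (b :: u == c :: v)%:R =
    (b == c)%:R * f (b :: v).
  under eq_bigr do rewrite eqseq_cons -mulnb natrM mulrCA.
  by rewrite -mulr_sumr (IH (fun u => f (b :: u))).
by rewrite !key; case: c {key}; rewrite /= ?mul1r ?mul0r ?addr0 ?add0r.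
Qed.

End bit_average.

(** * Mean square of the exponential sums of the walk *)

Section walk.
Context {R : realType}.
Variable inc : bool -> R.
Implicit Types (y : R) (v : bitseq).

(** [scanl] omits the starting value, so the list begins with the first step, as in the theorem. *)
Definition walk y v : seq R := scanl (fun z c => z + inc c) y v.

Variable h : nat.
Let freq : R := 2 * pi * h%:R.

(** Real and imaginary parts of the exponential sum relative to the start [y], so that their
    averages do not depend on [y]. *)
Let cc y v : R := \sum_(z <- walk y v) cos (freq * (z - y)).
Let ss y v : R := \sum_(z <- walk y v) sin (freq * (z - y)).

Let ux : R := (cos (freq * inc true) + cos (freq * inc false)) / 2.
Let uy : R := (sin (freq * inc true) + sin (freq * inc false)) / 2.

(** The complex number [u + u ^ 2 + ... + u ^ n] with [u = ux + i uy], through the recursion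
    [m -> u (1 + m)]. *)
Fixpoint walk_moment (n : nat) : R * R :=
  if n is m.+1 then
    let: (p, q) := walk_moment m in
    (ux * (1 + p) - uy * q, ux * q + uy * (1 + p))
  else (0, 0).

Let ccS y c v : cc y (c :: v) = cos (freq * inc c) +
  (cos (freq * inc c) * cc (y + inc c) v + - sin (freq * inc c) * ss (y + inc c) v).
Proof.
rewrite /cc /= big_cons; congr (_ + _).
  by rewrite [y + _]addrC addrK.
rewrite !mulr_sumr -big_split/=; apply: eq_bigr => z _; rewrite mulNr -cosD.
by congr cos; ring.
Qed.

Let ssS y c v : ss y (c :: v) = sin (freq * inc c) +
  (sin (freq * inc c) * cc (y + inc c) v + cos (freq * inc c) * ss (y + inc c) v).
Proof.
rewrite /ss /= big_cons; congr (_ + _).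
  by rewrite [y + _]addrC addrK.
rewrite !mulr_sumr -big_split/=; apply: eq_bigr => z _; rewrite -sinD.
by congr sin; ring.
Qed.

Let avg_cc_ss n y : bit_avg n (cc y) = (walk_moment n).1 /\
  bit_avg n (ss y) = (walk_moment n).2.
Proof.
elim: n y => [|n IH] y; first by rewrite !bit_avg0 /cc /ss !big_nil.
have key c : bit_avg n (cc y \o cons c) = cos (freq * inc c) +
      (cos (freq * inc c) * (walk_moment n).1 -
       sin (freq * inc c) * (walk_moment n).2) /\
    bit_avg n (ss y \o cons c) = sin (freq * inc c) +
      (sin (freq * inc c) * (walk_moment n).1 +
       cos (freq * inc c) * (walk_moment n).2).
  have [IH1 IH2] := IH (y + inc c); split.
    rewrite (eq_bit_avg _ (ccS y c)) bit_avgD bit_avg_cst.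
    by rewrite bit_avgD !bit_avgZ IH1 IH2 mulNr.
  by rewrite (eq_bit_avg _ (ssS y c)) bit_avgD bit_avg_cst bit_avgD !bit_avgZ IH1 IH2.
have [kt1 kt2] := key true; have [kf1 kf2] := key false.
rewrite !bit_avgS kt1 kt2 kf1 kf2 /= /ux /uy; case: (walk_moment n) => p q /=.
by split; field.
Qed.

(** Expands [|z + S| ^ 2 = 1 + 2 Re (conj z * S) + |S| ^ 2], where [z] is the term of the first
    point. *)
Let weyl_sqS y c v : weyl_sq h (walk y (c :: v)) =
  1 + (2 * cc (y + inc c) v + weyl_sq h (walk (y + inc c) v)).
Proof.
rewrite /weyl_sq /= !big_cons -/freq; set y1 := y + inc c.
have -> : cc y1 v = cos (freq * y1) * \sum_(z <- walk y1 v) cos (freq * z) +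
    sin (freq * y1) * \sum_(z <- walk y1 v) sin (freq * z).
  rewrite !mulr_sumr -big_split/=; apply: eq_bigr => z _.
  by rewrite mulrBr cosB [cos (freq * z) * _]mulrC [sin (freq * z) * _]mulrC.
rewrite -[X in _ = X + _](cos2Dsin2 (freq * y1)) -/(walk y1 v).
by ring.
Qed.

Let avg_weyl_sq n y : bit_avg n (fun v => weyl_sq h (walk y v)) =
  \sum_(m < n) (1 + 2 * (walk_moment m).1).
Proof.
elim: n y => [|n IH] y.
  by rewrite bit_avg0 big_ord0 /weyl_sq /= !big_nil expr0n addr0.
have key c : bit_avg n ((fun v => weyl_sq h (walk y v)) \o cons c) =
    1 + (2 * (walk_moment n).1 + \sum_(m < n) (1 + 2 * (walk_moment m).1)).
  rewrite (eq_bit_avg _ (weyl_sqS y c)) bit_avgD bit_avg_cst bit_avgD.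
  rewrite bit_avgZ IH.
  by have [-> _] := avg_cc_ss n (y + inc c).
by rewrite bit_avgS !key big_ord_recr/=; field.
Qed.

Let gap : R := sin (pi * (h%:R * inc true)) ^+ 2 +
  sin (pi * (h%:R * inc false)) ^+ 2.

Let gapE : gap = 1 - ux.
Proof.
have key c : cos (freq * inc c) = 1 - 2 * sin (pi * (h%:R * inc c)) ^+ 2.
  rewrite (_ : freq * inc c = (pi * (h%:R * inc c)) *+ 2); last first.
    by rewrite /freq -mulr_natl; ring.
  by rewrite cos_mulr2n cos2sin2; ring.
by rewrite /gap /ux !key; field.
Qed.

(* With [u = ux + i uy] and [m = walk_moment n] read as complex numbers,
   [1 - (1 - u) (1 + m) = u ^ n.+1], whose modulus is at most 1. *)
Let moment_bound n : gap * (1 + (walk_moment n).1) <= 2.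
Proof.
have u1 : ux ^+ 2 + uy ^+ 2 <= 1.
  rewrite /ux /uy; have := cos2Dsin2 (freq * inc true).
  have := cos2Dsin2 (freq * inc false).
  move: (cos _) (sin _) (cos _) (sin _) => a b c d e1 e2.
  have : 0 <= (a - c) ^+ 2 + (b - d) ^+ 2 by rewrite addr_ge0// sqr_ge0.
  nra.
pose e m := 1 - ((1 - ux) * (1 + (walk_moment m).1) + uy * (walk_moment m).2).
pose f m := - ((1 - ux) * (walk_moment m).2 - uy * (1 + (walk_moment m).1)).
have ef m : e m ^+ 2 + f m ^+ 2 <= 1.
  elim: m => [|m IH].
    have -> : e 0%N ^+ 2 + f 0%N ^+ 2 = ux ^+ 2 + uy ^+ 2; last by [].
    by rewrite /e /f /=; ring.
  have -> : e m.+1 ^+ 2 + f m.+1 ^+ 2 =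
      (ux ^+ 2 + uy ^+ 2) * (e m ^+ 2 + f m ^+ 2).
    rewrite /e /f /=; case: (walk_moment m) => p q /=; ring.
  by rewrite mulr_ile1// addr_ge0// sqr_ge0.
have := ef n; rewrite gapE {ef}.
rewrite /e /f.
move: (1 + (walk_moment n).1) (walk_moment n).2 (1 - ux) => p q g ef.
set A := g * p + uy * q in ef; set B := g * q - uy * p in ef.
(* [A + i B = (1 - u) (1 + m)] lies in the unit disc about 1, so its modulus is at most 2; as a
   product, it has modulus at least [|g p|]. *)
have AB : A ^+ 2 + B ^+ 2 <= 2 ^+ 2.
  have A2 : A <= 2.
    have : (1 - A) ^+ 2 <= 1 by apply: le_trans ef; rewrite lerDl sqr_ge0.
    nra.
  nra.
rewrite leNgt; apply/negP => gp2.
have : 2 ^+ 2 < (g * p) ^+ 2 by rewrite ltr_pXn2r// nnegrE// ltW// (lt_trans _ gp2).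
have : A ^+ 2 + B ^+ 2 = (g * p) ^+ 2 + (g * q) ^+ 2 + (uy * p) ^+ 2 + (uy * q) ^+ 2.
  by rewrite /A /B; ring.
have := sqr_ge0 (g * q); have := sqr_ge0 (uy * p); have := sqr_ge0 (uy * q).
by lra.
Qed.

(** Each of the [n] terms [1 + 2 Re m] is at most [2 (1 + Re m) <= 4 / g]. *)
Lemma bit_avg_weyl_sq_le n y g : 0 < g ->
  g <= sin (pi * (h%:R * inc true)) ^+ 2 + sin (pi * (h%:R * inc false)) ^+ 2 ->
  bit_avg n (fun v => weyl_sq h (walk y v)) <= 4 * n%:R / g.
Proof.
move=> g0 gle; rewrite avg_weyl_sq.
apply: (@le_trans _ _ (\sum_(m < n) 4 / g)); last first.
  by rewrite sumr_const card_ord -[leLHS]mulr_natr mulrAC.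
apply: ler_sum => m _; rewrite -/gap in gle.
have gap0 := lt_le_trans g0 gle.
have : 1 + (walk_moment m).1 <= 2 / gap.
  by rewrite ler_pdivlMr// mulrC moment_bound.
have : 2 / gap <= 2 / g by rewrite ler_pM2l// lef_pV2.
by lra.
Qed.

End walk.

(** * Consequences of the Diophantine condition; power sums *)

Section diophantine.
Context {R : realType}.
Implicit Types (x alpha C : R).

Lemma dist_nearest_int_le x (n : int) : dist_nearest_int x <= `|x - n%:~R|.
Proof. by apply: ge_inf; [exists 0 => _ [m _ <-] | exists n]. Qed.

Lemma dist_nearest_int_ge0 x : 0 <= dist_nearest_int x.
Proof.
by apply: lb_le_inf; [exists `|x - 0%:~R|, 0 | move=> _ [n _ <-]].
Qed.

(** The square of the sine has period [pi], so [x] may be replaced by its signed distance [r] to a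
    nearest integer. *)
Lemma sqr_dist_nearest_int_le_sin x :
  dist_nearest_int x ^+ 2 <= sin (pi * x) ^+ 2.
Proof.
have d0 := dist_nearest_int_ge0 x; set n := Num.floor (x + 1 / 2); pose r := x - n%:~R.
have r1 : - (1 / 2) <= r by have := floor_le (x + 1 / 2); rewrite -/n /r; lra.
have r2 : r < 1 / 2.
  by have := floorD1_gt (x + 1 / 2); rewrite -/n /r intrD; lra.
have sqN (m : nat) (y : R) : sin (y + pi *+ m) ^+ 2 = sin y ^+ 2.
  rewrite alternatingn; last by move=> z; exact: sinDpi.
  by rewrite exprMn -exprM mulnC exprM sqrrN expr1n expr1n mul1r.
have -> : sin (pi * x) ^+ 2 = sin (pi * r) ^+ 2.
  rewrite /r; case: n {r r1 r2} => m.
    by rewrite -[RHS](sqN m); congr (sin _ ^+ 2); rewrite mulrBr mulr_natr subrK.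
  rewrite -(sqN m.+1); congr (sin _ ^+ 2).
  by rewrite NegzE mulrNz opprK mulrDr mulr_natr.
have -> : sin (pi * r) ^+ 2 = sin (pi * `|r|) ^+ 2.
  by have [|] := ger0P r => // _; rewrite mulrN sinN sqrrN.
have rn : `|r| <= 1 / 2 by rewrite ler_norml; lra.
have rs : `|r| <= sin (pi * `|r|) by apply: le_sin_pi; rewrite normr_ge0.
have dr : dist_nearest_int x <= `|r| by exact: dist_nearest_int_le.
rewrite lerXn2r ?nnegrE//; first by rewrite (le_trans _ rs).
exact: le_trans dr rs.
Qed.

(** Pigeonhole: with [M > 1 / C], two of the [M ^ 2 + 1] multiples with [0 <= k <= M ^ 2] share one
    of the [M ^ 2] square cells of side [1 / M]; their difference works. *)
Lemma simultaneous_approx (theta1 theta2 C : R) : 0 < C ->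
  exists2 k : nat, (1 <= k)%N &
    Num.max (dist_nearest_int (k%:R * theta1))
            (dist_nearest_int (k%:R * theta2)) < C.
Proof.
move=> C0; pose m := Num.trunc C^-1; pose M : R := m.+1%:R.
have M0 : 0 < M by rewrite ltr0n.
have CM : M^-1 < C.
  have /andP[_ h] : m%:R <= C^-1 < M by apply: truncn_itv; rewrite invr_ge0 ltW.
  by rewrite -[ltRHS]invrK ltf_pV2// posrE invr_gt0.
have f01 (x : R) : 0 <= frac_part x < 1.
  rewrite /frac_part; have := floor_le x; have := floorD1_gt x.
  by rewrite intrD; lra.
(* [inord] never takes its default value, since [frac_part] is below 1. *)
pose cell (t : R) (k : nat) : 'I_m.+1 := inord (Num.trunc (M * frac_part (k%:R * t))).
have cell_near t i j : cell t i = cell t j -> (i <= j)%N ->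
    dist_nearest_int ((j - i)%:R * t) < C.
  move=> cij ij; apply: le_lt_trans CM.
  have tr (k : nat) : (cell t k)%:R <= M * frac_part (k%:R * t) < (cell t k).+1%:R.
    have /andP[f0 f1] := f01 (k%:R * t).
    have h0 : 0 <= M * frac_part (k%:R * t) by rewrite mulr_ge0// ltW.
    have /andP[h1 h2] := truncn_itv h0.
    rewrite /cell inordK ?h1 ?h2//.
    rewrite -(ltr_nat R); apply: le_lt_trans h1 _.
    by rewrite -/M -[ltRHS]mulr1 ltr_pM2l.
  apply: le_trans (dist_nearest_int_le _
    (Num.floor (j%:R * t) - Num.floor (i%:R * t))) _.
  rewrite (_ : _ - _ = frac_part (j%:R * t) - frac_part (i%:R * t)); last first.
    by rewrite /frac_part natrB// intrB; ring.
  rewrite -(ler_pM2l M0) divff ?gt_eqF// -[X in X * _]gtr0_norm// -normrM mulrBr.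
  have := tr i; have := tr j; rewrite cij -natr1 => /andP[a1 a2] /andP[b1 b2].
  by rewrite ler_norml; lra.
pose f (k : 'I_(m.+1 * m.+1).+1) := (cell theta1 k, cell theta2 k).
have /injectivePn[i [j ij [e1 e2]]] : ~~ injectiveb f.
  apply/negP => /injectiveP /leq_card.
  by rewrite card_prod !card_ord ltnn.
wlog lij : i j ij e1 e2 / (i < j)%N.
  move=> wl; have [lij|lji|eij] := ltngtP i j; first exact: wl ij e1 e2 lij.
    by apply: wl lji; rewrite // eq_sym.
  by move: ij; rewrite -val_eqE/= eij eqxx.
exists (j - i)%N; first by rewrite subn_gt0.
by rewrite gt_max !cell_near// ltnW.
Qed.

(** If [alpha <= 0], then [k ^ (- alpha) >= 1] and the maximum would stay above [C]. *)
Lemma diophantine2_gt0 (theta1 theta2 alpha : R) :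
  diophantine2 theta1 theta2 alpha -> 0 < alpha.
Proof.
move=> [C C0 dio]; rewrite ltNge; apply/negP => a0.
have [k k1] := simultaneous_approx theta1 theta2 C0.
rewrite ltNge => /negP; apply; apply: le_trans (dio k k1).
have : k%:R `^ 0 <= k%:R `^ (- alpha) by rewrite ler_powR ?oppr_ge0 ?ler1n.
by rewrite powRr0 => k0; rewrite ler_peMr ?(ltW C0).
Qed.

Lemma diophantine2_sin (theta1 theta2 alpha : R) :
  diophantine2 theta1 theta2 alpha -> exists2 C : R, 0 < C &
  forall h : nat, (1 <= h)%N -> (C / h%:R `^ alpha) ^+ 2 <=
    sin (pi * (h%:R * theta1)) ^+ 2 + sin (pi * (h%:R * theta2)) ^+ 2.
Proof.
move=> [C C0 dio]; exists C => // h h1; have := dio h h1; rewrite powRN => hC.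
set s := sin _ ^+ 2 + _.
have dle (t : R) : sin (pi * (h%:R * t)) ^+ 2 <= s ->
    C / h%:R `^ alpha <= dist_nearest_int (h%:R * t) ->
    (C / h%:R `^ alpha) ^+ 2 <= s.
  move=> ss cd; apply: le_trans ss.
  apply: le_trans (sqr_dist_nearest_int_le_sin _).
  by rewrite lerXn2r ?nnegrE ?dist_nearest_int_ge0// divr_ge0 ?powR_ge0// ltW.
move: hC; rewrite le_max => /orP[]; apply: dle.
- by rewrite lerDl sqr_ge0.
- by rewrite lerDr sqr_ge0.
Qed.

(** With [x = 1 / (n + 1)]: [(1 - x) ^ alpha <= 1 / (1 + alpha x) <= 1 - alpha x / (1 + alpha)], the
    last step by [x <= 1]. The case [n = 0], where [1 - x = 0], is separate. *)
Lemma le_powR_succ alpha (n : nat) : 0 < alpha ->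
  alpha / (1 + alpha) * (n.+1%:R^-1 * n.+1%:R `^ alpha) <=
  n.+1%:R `^ alpha - n%:R `^ alpha.
Proof.
move=> a0; set A := n.+1%:R `^ alpha; have A0 : 0 < A by rewrite powR_gt0// ltr0n.
pose x : R := n.+1%:R^-1.
have x0 : 0 < x by rewrite invr_gt0 ltr0n.
have x1 : x <= 1 by rewrite invf_le1 ?ltr0n// ler1n.
rewrite -/x.
suff : n%:R `^ alpha <= A * (1 - alpha * x / (1 + alpha)).
  move=> h; rewrite -subr_ge0; move: h; rewrite -subr_ge0.
  by congr (0 <= _); field; rewrite gt_eqF// addr_gt0.
case: n @A A0 @x x0 x1 => [|n] A A0 x x0 x1.
  rewrite powR0 ?gt_eqF// mulr_ge0 ?(ltW A0)// subr_ge0.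
  by rewrite ler_pdivrMr ?addr_gt0// mul1r; nra.
have nE : n.+1%:R = n.+2%:R * (1 - x) :> R.
  by rewrite /x mulrBr mulr1 divff// -[n.+2%:R]natr1 addrK.
have x1' : x < 1 by rewrite invf_lt1 ?ltr0n// ltr1n.
rewrite nE powRM ?subr_ge0// -/A ler_pM2l// /powR gt_eqF ?subr_gt0//.
apply: (@le_trans _ _ (1 + alpha * x)^-1).
  rewrite -[leLHS]invrK lef_pV2 ?posrE ?invr_gt0 ?expR_gt0 ?addr_gt0 ?mulr_gt0//.
  rewrite -expRN; apply: le_trans (expR_ge1Dx _); rewrite lerD2l -mulrN ler_pM2l//.
  by rewrite lerNr; apply: le_ln1Dx; lra.
rewrite -[leLHS]mul1r ler_pdivrMr ?addr_gt0 ?mulr_gt0//.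
rewrite [leRHS](_ : _ = 1 + alpha ^+ 2 * x * (1 - x) / (1 + alpha)); last first.
  by field; rewrite gt_eqF// addr_gt0.
by rewrite lerDl divr_ge0 ?mulr_ge0 ?sqr_ge0 ?subr_ge0 ?ltW ?addr_gt0.
Qed.

(** Telescopes [le_powR_succ]; the induction bounds the sum by the power of the last index
    [H - 1]. *)
Lemma sum_powR_le alpha (H : nat) : 0 < alpha ->
  \sum_(1 <= h < H) h%:R^-1 * h%:R `^ alpha <=
  (1 + alpha) / alpha * H%:R `^ alpha.
Proof.
move=> a0; have c0 : 0 < (1 + alpha) / alpha by rewrite divr_gt0// addr_gt0.
case: H => [|H]; first by rewrite big_geq// mulr_ge0 ?powR_ge0// ltW.
apply: (@le_trans _ _ ((1 + alpha) / alpha * H%:R `^ alpha)); last first.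
  by rewrite ler_pM2l// ge0_ler_powR ?nnegrE ?(ltW a0)// ler_nat.
elim: H => [|H IH]; first by rewrite big_geq// mulr_ge0 ?powR_ge0// ltW.
rewrite big_nat_recr//=; apply: le_trans (lerD IH (lexx _)) _.
have := le_powR_succ H a0; rewrite -(ler_pM2l c0) mulrA.
rewrite (_ : (1 + alpha) / alpha * (alpha / (1 + alpha)) = 1); last first.
  by field; rewrite !gt_eqF ?addr_gt0.
by rewrite mul1r mulrBr lerBrDl.
Qed.

End diophantine.

(** * Expectation over the coins as a finite average *)

(** The integrand is a combination of indicators of the cylinders [A v], each of probability
    [2 ^ (- n)] by independence. *)
Lemma expectation_fair_coins (d : measure_display) (T : measurableType d)
    (R : realType) (P : probability T R) (b : nat -> {RV P >-> bool}) (n : nat)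
    (f : bitseq -> R) : fair_coins b -> (forall v, 0 <= f v) ->
  ('E_P[fun w => f (mkseq (fun i => b i w) n)] = (bit_avg n f)%:E)%E.
Proof.
move=> [fair indep] f0.
pose A v := [set w | mkseq (fun i => b i w) n = v].
have AE v : size v = n ->
    A v = \big[setI/setT]_(i <- iota 0 n) (b i @^-1` [set nth false v i]).
  move=> sv; rewrite -bigcap_seq; apply/seteqP; split => w /=.
    by move=> <- i /=; rewrite mem_iota => /= ni; rewrite nth_mkseq.
  move=> bw; apply: (@eq_from_nth _ false); first by rewrite size_mkseq.
  rewrite size_mkseq => i ni; rewrite nth_mkseq//.
  by apply: bw; rewrite /= mem_iota.
have mA v : measurable (A v).
  have [sv|sv] := eqVneq (size v) n.
    rewrite AE// -bigcap_seq; apply: fin_bigcap_measurable => // i _.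
    exact: measurable_funPTI.
  rewrite (_ : A v = set0)//; apply/seteqP; split => w //= Aw.
  by move: sv; rewrite -Aw size_mkseq eqxx.
have PA v : size v = n -> P (A v) = (2^-1 ^+ n)%:E.
  move=> sv; rewrite AE// (indep (iota 0 n) (fun i => [set nth false v i])) ?iota_uniq//.
  under eq_bigr do rewrite fair.
  by rewrite prodEFin big_const_seq count_predT size_iota iter_mulr_1.
pose g v w : \bar R := (f v * \1_(A v) w)%:E.
rewrite expectation.unlock.
transitivity (\int[P]_w (\sum_(v <- bitseqs n) g v w))%E.
  apply: eq_integral => w _.
  rewrite sumEFin; congr EFin.
  rewrite -[LHS](@sum_bitseqs_delta _ n) ?size_mkseq//.
  apply: eq_bigr => v _; rewrite indicE; congr (_ * _%:R).
  by congr nat_of_bool; apply/idP/idP => [/eqP ->|/set_mem <-//]; rewrite ?mem_set.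
rewrite ge0_integral_sum//; last 2 first.
- by move=> v; apply/measurable_EFinP/measurable_funM.
- by move=> v w _; rewrite lee_fin mulr_ge0.
rewrite /bit_avg mulr_sumr -sumEFin big_seq [RHS]big_seq.
apply: eq_bigr => v /size_bitseqs sv.
rewrite (integralZl_indic measurableT (fun=> A v))//; last first.
  by move=> fv0; have := f0 v; rewrite leNgt fv0.
by rewrite integral_indic//= setIT PA// -EFinM mulrC.
Qed.

(** * Averaged discrepancy of the walk *)

Section main.
Context {R : realType}.
Variables (inc : bool -> R) (alpha C : R).
Hypotheses (alpha_gt0 : 0 < alpha) (C_gt0 : 0 < C).
Hypothesis gap : forall h : nat, (1 <= h)%N -> (C / h%:R `^ alpha) ^+ 2 <=
  sin (pi * (h%:R * inc true)) ^+ 2 + sin (pi * (h%:R * inc false)) ^+ 2.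

Lemma size_walk y v : size (walk inc y v) = size v.
Proof. exact: size_scanl. Qed.

(** With [l = a r] below, [1 / 2] comes from the term [l / 2] and [2 / C ^+ 2] from the mean square
    bound. *)
Let K := 1 / 2 + 2 / C ^+ 2.

(* AM-GM, [|S| <= (l + |S|^2 / l) / 2] with [l] of the order of the root mean
   square of [|S|], replaces the Cauchy-Schwarz inequality. *)
Lemma bit_avg_weyl_le (n h : nat) y : (0 < n)%N -> (0 < h)%N ->
  bit_avg n (fun v => n%:R^-1 * Num.sqrt (weyl_sq h (walk inc y v))) <=
  K * (h%:R `^ alpha * Num.sqrt n%:R^-1).
Proof.
move=> n0 h0; set a := h%:R `^ alpha; set r := Num.sqrt n%:R^-1.
have a0 : 0 < a by rewrite powR_gt0// ltr0n.
have nR : 0 < n%:R :> R by rewrite ltr0n.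
have r0 : 0 < r by rewrite sqrtr_gt0 invr_gt0.
have r2 : r ^+ 2 = n%:R^-1 by rewrite sqr_sqrtr// invr_ge0 ltW.
have l0 : 0 < a * r by rewrite mulr_gt0.
apply: (@le_trans _ _ (bit_avg n (fun v => a * r / 2 +
    (n%:R^-1 ^+ 2 / (2 * (a * r))) * weyl_sq h (walk inc y v)))).
  apply: le_bit_avg => v _; have := weyl_sq_ge0 h (walk inc y v).
  move: (weyl_sq _ _) => W W0; have W2 := sqr_sqrtr W0.
  rewrite -{2}W2; move: (Num.sqrt W) => S.
  rewrite -subr_ge0 (_ : _ - _ = (a * r - n%:R^-1 * S) ^+ 2 / (2 * (a * r))).
    by rewrite divr_ge0 ?sqr_ge0// mulr_ge0// ltW.
  by field; rewrite !gt_eqF.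
rewrite bit_avgD bit_avg_cst bit_avgZ.
have g0 : 0 < (C / a) ^+ 2 by rewrite exprn_gt0// divr_gt0.
have := bit_avg_weyl_sq_le n y g0 (gap h0).
have k0 : 0 < n%:R^-1 ^+ 2 / (2 * (a * r)).
  by rewrite divr_gt0 ?mulr_gt0 ?exprn_gt0 ?invr_gt0.
rewrite -(ler_pM2l k0) => le1; apply: le_trans (lerD (lexx _) le1) _.
rewrite /K le_eqVlt; apply/orP; left; apply/eqP.
have -> : n%:R = r ^- 2 by rewrite r2 invrK.
by field; rewrite !gt_eqF.
Qed.

Lemma bit_avg_discrepancy_le (n : nat) y : (0 < n)%N ->
  bit_avg n (fun v => discrepancy (walk inc y v)) <=
  (3 * K * ((1 + alpha) / alpha) * 2 `^ alpha + 92) *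
    n%:R `^ (- (2 * (1 + alpha))^-1).
Proof.
move=> n0; set beta := (2 * (1 + alpha))^-1; pose r : R := n%:R `^ beta.
have nR : 0 < n%:R :> R by rewrite ltr0n.
have beta0 : 0 < beta by rewrite invr_gt0 mulr_gt0// addr_gt0.
have r0 : 0 < r by rewrite powR_gt0.
have r1 : 1 <= r.
  have : n%:R `^ 0 <= r by rewrite ler_powR ?(ltW beta0)// ler1n.
  by rewrite powRr0.
(* This gives [r <= H <= 2 r], the upper bound because [r >= 1]. *)
pose H := (Num.trunc r).+1.
have rH : r <= H%:R by have /andP[_ /ltW] := truncn_itv (ltW r0).
have Hr : H%:R <= 2 * r.
  have /andP[h _] := truncn_itv (ltW r0).
  by rewrite /H -natr1; lra.
have HR : 0 < H%:R :> R by rewrite ltr0n.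
have K0 : 0 < K by rewrite addr_gt0 ?divr_gt0 ?exprn_gt0.
have rn : n%:R `^ (- beta) = r^-1 by rewrite powRN.
(* The choice of [beta] balances the two error terms: [alpha * beta - 1 / 2 = - beta]. *)
have rE : r `^ alpha * Num.sqrt n%:R^-1 = r^-1.
  have -> : Num.sqrt n%:R^-1 = n%:R `^ (-1 * 2^-1) :> R.
    by rewrite powRrM powR_inv1// powR12_sqrt// invr_ge0.
  rewrite -rn /r -powRrM -powRD.
    by congr (_ `^ _); rewrite /beta; field; rewrite gt_eqF// addr_gt0.
  by apply/implyP => _; rewrite gt_eqF.
apply: (@le_trans _ _ (3 * \sum_(1 <= h < H) h%:R^-1 *
    (K * (h%:R `^ alpha * Num.sqrt n%:R^-1)) + 92 * H%:R^-1)).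
  apply: (@le_trans _ _ (bit_avg n (fun v => 3 * \sum_(1 <= h < H) h%:R^-1 *
    (n%:R^-1 * Num.sqrt (weyl_sq h (walk inc y v))) + 92 * H%:R^-1))).
    apply: le_bit_avg => v sv.
    have sw : size (walk inc y v) = n by rewrite size_walk.
    by have := @erdos_turan _ H (walk inc y v); rewrite sw; apply.
  rewrite bit_avgD bit_avg_cst bit_avgZ lerD2r ler_pM2l// bit_avg_sum.
  rewrite big_nat [leRHS]big_nat; apply: ler_sum => h /andP[h0 _].
  by rewrite bit_avgZ ler_pM2l ?invr_gt0 ?ltr0n// bit_avg_weyl_le.
rewrite rn [leRHS]mulrDl; apply: lerD; last by rewrite ler_pM2l// lef_pV2.
have sE : \sum_(1 <= h < H) h%:R^-1 * (K * (h%:R `^ alpha * Num.sqrt n%:R^-1)) =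
    K * Num.sqrt n%:R^-1 * \sum_(1 <= h < H) h%:R^-1 * h%:R `^ alpha :> R.
  by rewrite mulr_sumr; apply: eq_bigr => h _; ring.
have Ha : H%:R `^ alpha <= 2 `^ alpha * r `^ alpha.
  by rewrite -powRM ?(ltW r0)// ge0_ler_powR ?nnegrE ?(ltW alpha_gt0)// mulr_ge0// ltW.
rewrite sE -rE -!mulrA ler_pM2l// ler_pM2l//.
have s0 : 0 <= Num.sqrt n%:R^-1 :> R by exact: sqrtr_ge0.
apply: le_trans (ler_wpM2l s0 (sum_powR_le H alpha_gt0)) _.
have c0 : 0 < (1 + alpha) / alpha by rewrite divr_gt0// addr_gt0.
have := ler_wpM2l s0 (ler_wpM2l (ltW c0) Ha).
by move/le_trans; apply; rewrite le_eqVlt; apply/orP; left; apply/eqP; ring.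
Qed.

End main.

(** * Transfer to the process *)

Lemma discrepancy_ge0 (R : realType) (s : seq R) : 0 <= discrepancy s.
Proof.
rewrite /discrepancy; set S := [set x | _].
have S0 : S `<=` [set x | 0 <= x] by move=> _ [a [b [_ _ _ ->]]] /=.
(* Without a supremum, [sup] would return its default value 0. *)
have [supS|] := pselect (has_sup S); last by move=> /sup_out ->.
have [[x Sx] ub] := supS; exact: le_trans (S0 _ Sx) (ub_le_sup ub Sx).
Qed.

Lemma process_walk (T : Type) (R : realType) (inc : bool -> R) (y0 : R)
    (y : nat -> T -> R) (b : nat -> T -> bool) (w : T) (n : nat) :
  y 0%N w = y0 -> (forall n, y n.+1 w = y n w + inc (b n w)) ->
  [seq y i w | i <- iota 1 n] = walk inc y0 (mkseq (fun i => b i w) n).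
Proof.
move=> <- yS; rewrite /mkseq /walk.
(* The starting index is generalised, so that it advances with the walk. *)
elim: n 0%N => [//|n IH] m; rewrite /= -yS; congr (_ :: _).
exact: IH.
Qed.

Theorem theorem4p2 (R : realType) (theta1 theta2 alpha : R)
    (hdioph : diophantine2 theta1 theta2 alpha) :
  exists C2 : R,
    forall (d : measure_display) (T : measurableType d) (P : probability T R)
      (y0 : R) (y : nat -> T -> R),
      is_process P theta1 theta2 y0 y ->
      forall N : nat, (1 <= N)%N ->
        ('E_P[fun w : T => discrepancy [seq y i w | i <- iota 1 N]]
           <= (C2 * N%:R `^ (- (2 * (1 + alpha))^-1))%:E)%E.
Proof.
have alpha0 := diophantine2_gt0 hdioph.
have [C C0 gap] := diophantine2_sin hdioph.
pose inc c := if c then theta1 else theta2.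
(* The constant is fixed later by unification with [bit_avg_discrepancy_le]; it involves only
   [alpha] and [C]. *)
eexists => d T P y0 y [b [fair y0E yS]] N N1.
rewrite (_ : (fun w => _) =
    fun w => discrepancy (walk inc y0 (mkseq (fun i => b i w) N))).
  rewrite (expectation_fair_coins N (f := fun v => discrepancy (walk inc y0 v)))//.
    by rewrite lee_fin; exact: (@bit_avg_discrepancy_le R inc alpha C).
  by move=> v; exact: discrepancy_ge0.
apply/funext => w; congr discrepancy.
exact: (process_walk (b := b) N (y0E w) (yS^~ w)).
Qed.
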